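(* Let $T:\mathbb{N}\to\mathbb{N}$ be the Collatz map and $S=T\circ T\circ T$ its third iterate. The fixed points of $S$, i.e. the solutions $n\in\mathbb{N}$ of $S(n)=n$, are exactly $1$, $2$ and $4$.
   Context: $\mathbb{N}$ denotes the positive integers. The Collatz map $T:\mathbb{N}\to\mathbb{N}$ is $T(n)=n/2$ if $n$ is even and $T(n)=3n+1$ if $n$ is odd. *)

(* Defs.v *)
From mathcomp Require Import all_boot.

Set Implicit Arguments.
Unset Strict Implicit.
Unset Printing Implicit Defensive.

(* The Collatz map lives on the positive integers.  It is defined here on all
   of [nat], with the junk value [collatz 0 = 0]; [collatz_gt0] shows that it
   restricts to a self-map of the positive integers. *)
Definition collatz (n : nat) : nat := if odd n then 3 * n + 1 else n %/ 2.

Lemma collatz_gt0 (n : nat) : 0 < n -> 0 < collatz n.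
Proof. by rewrite /collatz; case: n => [|[|n]] // _; case: ifP; rewrite ?addn1 // divn_gt0. Qed.

Definition collatz3 : nat -> nat := collatz \o collatz \o collatz.

(* Main.v *)
Require Import Defs.
From mathcomp Require Import all_boot.
From mathcomp Require Import zify.

(** Each step of the Collatz map is affine, going either up by [x |-> 3x + 1]
    or down by [x |-> x/2], so a point of period dividing 3 solves one of eight
    linear systems.  Three steps down give [n = 8n], and two or three steps up
    make the value grow overall; neither has a positive solution.  Exactly one
    step up leads to [3x + 1 = 4x], where [x] is the point at which it is taken,
    so [x = 1] and the orbit is [1, 4, 2]; the three positions of that step in
    the cycle give the three values of [n]. *)

(** A step down starts from an even number, so the truncated quotient is an
    exact half and the step becomes a linear equation. *)
Lemma collatz_step (n : nat) :
  collatz n = 3 * n + 1 \/ n = 2 * collatz n.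
Proof. by rewrite /collatz; case: ifP => ?; [left | right; lia]. Qed.

Theorem mainTheorem2 (n : nat) (n_gt0 : 0 < n) :
  collatz3 n = n <-> n = 1 \/ n = 2 \/ n = 4.
Proof.
split; last by case=> [|[]] ->.
rewrite /collatz3 /=.
have := collatz_step (collatz (collatz n)).
have := collatz_step (collatz n).
have := collatz_step n.
lia.
Qed.
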